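(* Let $\mathbb{A}$ be a finite-dimensional, local, associative and commutative (unital) real algebra, decomposed as $\mathbb{A}=\mathbb{R}\oplus\mathbb{N}$ with $\mathbb{N}$ its maximal ideal, and let $\mathbb{S}$ be the annihilator of $\mathbb{N}$ in $\mathbb{A}$ (the socle of $\mathbb{A}$). Then the real Lie algebra $\mathcal{H}_1(\mathbb{A})$ is a symplectic Lie algebra if and only if $\dim_{\mathbb{R}}\mathbb{A}$ is even and $\dim_{\mathbb{R}}\mathbb{S}\le 2$. Moreover, for $k\ge 2$ the real Lie algebra $\mathcal{H}_k(\mathbb{A})$ is not symplectic.
   Context: $\mathcal{H}_k(\mathbb{A})=\mathcal{H}_k(\mathbb{R})\otimes_{\mathbb{R}}\mathbb{A}$ is the Heisenberg Lie algebra over $\mathbb{A}$, viewed as a real Lie algebra of dimension $(2k+1)\dim_{\mathbb{R}}\mathbb{A}$: it is the free $\mathbb{A}$-module with basis $e_1,\dots,e_k,f_1,\dots,f_k,g$ with $\mathbb{A}$-bilinear bracket whose only nonzero basis brackets (up to antisymmetry) are $[e_i,f_i]=g$. A real Lie algebra $\mathfrak{g}$ is symplectic if it has a nondegenerate scalar 2-cocycle, i.e. a nondegenerate alternating $\mathbb{R}$-bilinear form $\omega$ with $\omega([x,y],z)+\omega([y,z],x)+\omega([z,x],y)=0$ for all $x,y,z\in\mathfrak{g}$. *)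

(* Defs.v *)
From HB Require Import structures.
From mathcomp Require Import all_boot all_order all_algebra.
From mathcomp Require Import falgebra.
From mathcomp Require Export reals.

Set Implicit Arguments.
Unset Strict Implicit.
Unset Printing Implicit Defensive.

Import GRing.Theory.
Local Open Scope ring_scope.

(* The inverse operation carried by a comFalgType is no extra datum: it exists *)
(* on every finite-dimensional algebra (factory Algebra_isFalgebra).          *)
#[short(type="comFalgType")]
HB.structure Definition ComFalgebra (K : nzRingType) :=
  { A of Vector K A & GRing.ComUnitAlgebra K A }.

HB.mixin Record Lmodule_isLieAlgebra (K : comNzRingType) L
    of GRing.Lmodule K L := {
  lie : L -> L -> L;
  lie_linearl : forall y, linear (lie^~ y);
  lie_linearr : forall x, linear (lie x);
  liexx : forall x, lie x x = 0;
  lie_jacobi : forall x y z,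
    lie x (lie y z) + lie y (lie z x) + lie z (lie x y) = 0
}.

#[short(type="lieAlgType")]
HB.structure Definition LieAlgebra (K : comNzRingType) :=
  { L of GRing.Lmodule K L & Lmodule_isLieAlgebra K L }.

Section Symplectic.
Variables (K : comNzRingType) (L : lieAlgType K).

Definition alternating_form (omega : {biscalar L}) :=
  forall x, omega x x = 0.

Definition nondegenerate_form (omega : {biscalar L}) :=
  forall x, (forall y, omega x y = 0) -> x = 0.

Definition scalar_2cocycle (omega : {biscalar L}) :=
  forall x y z,
    omega (lie x y) z + omega (lie y z) x + omega (lie z x) y = 0.

Definition symplectic_lie := exists omega : {biscalar L},
  [/\ alternating_form omega, nondegenerate_form omega
    & scalar_2cocycle omega].

End Symplectic.

Section LocalRing.
Variable A : comNzRingType.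

(* idealr_closed includes properness (1 \notin I). Letting ideals be boolean   *)
(* predicates loses nothing for finite-dimensional A, whose ideals are         *)
(* subspaces.                                                                 *)
Definition maximal_ideal (M : {pred A}) :=
  idealr_closed M /\
  forall I : {pred A}, idealr_closed I -> {subset M <= I} -> I =i M.

Definition local_ring :=
  exists2 M : {pred A}, maximal_ideal M &
    forall M' : {pred A}, maximal_ideal M' -> M' =i M.

End LocalRing.

Section Annihilator.
Variables (K : fieldType) (A : comFalgType K).

Definition annihilator (V : {vspace A}) : {vspace A} :=
  (\bigcap_(i < \dim V) lker (amulr (vbasis V)`_i))%VS.

Lemma annihilatorP (V : {vspace A}) (a : A) :
  reflect (forall v, v \in V -> a * v = 0) (a \in annihilator V).
Proof.
apply: (iffP subv_bigcapP) => [aV v /coord_vbasis-> | aV i _].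
  rewrite mulr_sumr big1 // => i _.
  have := aV i isT; rewrite -memvE memv_ker lfunE /= => /eqP ai0.
  by rewrite -scalerAr ai0 scaler0.
rewrite -memvE memv_ker lfunE /= aV //.
by rewrite vbasis_mem ?mem_nth ?size_tuple.
Qed.

End Annihilator.

(* The triple (x, y, z) stands for                                            *)
(*   \sum_i x i *: e_i + \sum_i y i *: f_i + z *: g   with x i, y i, z in A,  *)
(* regarded as a Lie algebra over K by restriction of scalars.                *)
Definition heisenberg (K : fieldType) (k : nat) (A : comFalgType K) : Type :=
  ({ffun 'I_k -> A} * {ffun 'I_k -> A} * A)%type.

Section Heisenberg.
Variables (K : fieldType) (k : nat) (A : comFalgType K).
Local Notation H := (heisenberg k A).

HB.instance Definition _ :=
  Vector.copy H ({ffun 'I_k -> A} * {ffun 'I_k -> A} * A)%type.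

Definition heis_bracket (u v : H) : H :=
  (0, 0, \sum_(i < k) (u.1.1 i * v.1.2 i - v.1.1 i * u.1.2 i)).

Fact heis_bracket_linearl v : linear (heis_bracket^~ v).
Proof.
move=> a u u'; apply: (congr2 pair).
  by apply: (congr2 pair); rewrite /= scaler0 addr0.
rewrite /= scaler_sumr -big_split /=; apply: eq_bigr => i _.
rewrite !ffunE mulrDl mulrDr -scalerAl -scalerAr scalerBr opprD.
by rewrite addrACA.
Qed.

Fact heis_bracketC u v : heis_bracket u v = - heis_bracket v u.
Proof.
apply: (congr2 pair); first by apply: (congr2 pair); rewrite oppr0.
by rewrite /= -sumrN; apply: eq_bigr => i _; rewrite opprB.
Qed.

Fact heis_bracket_linearr u : linear (heis_bracket u).
Proof.
move=> a v v'; rewrite ![heis_bracket u _]heis_bracketC heis_bracket_linearl.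
by rewrite opprD scalerN.
Qed.

Fact heis_bracketxx u : heis_bracket u u = 0.
Proof.
apply: (congr2 pair) => //=.
by rewrite big1 // => i _; rewrite subrr.
Qed.

Fact heis_bracket_nilp u v w : heis_bracket u (heis_bracket v w) = 0.
Proof.
apply: (congr2 pair) => //=.
by rewrite big1 // => i _; rewrite !ffunE mulr0 mul0r subrr.
Qed.

Fact heis_jacobi u v w :
  heis_bracket u (heis_bracket v w) + heis_bracket v (heis_bracket w u)
    + heis_bracket w (heis_bracket u v) = 0.
Proof. by rewrite !heis_bracket_nilp !addr0. Qed.

HB.instance Definition _ := Lmodule_isLieAlgebra.Build K H
  heis_bracket_linearl heis_bracket_linearr heis_bracketxx heis_jacobi.

(* The multiples a e_i, a f_i and a g of the basis vectors, for a in A. *)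
Definition heis_e (i : 'I_k) (a : A) : H :=
  ([ffun j => if j == i then a else 0], 0, 0).
Definition heis_f (i : 'I_k) (a : A) : H :=
  (0, [ffun j => if j == i then a else 0], 0).
Definition heis_g (a : A) : H := (0, 0, a).

Lemma lie_heis_ef i j a b :
  lie (heis_e i a) (heis_f j b) = if i == j then heis_g (a * b) else 0.
Proof.
rewrite /lie /= /heis_bracket /=.
rewrite (bigD1 i) //= big1 ?addr0 => [|l li]; last first.
  by rewrite !ffunE (negPf li) !mul0r subrr.
by rewrite !ffunE eqxx mul0r subr0; case: eqVneq => // _; rewrite mulr0.
Qed.

Lemma lie_heis_ee i j a b : lie (heis_e i a) (heis_e j b) = 0.
Proof.
apply: (congr2 pair) => //=.
by rewrite big1 // => l _; rewrite !ffunE !mulr0 subrr.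
Qed.

Lemma lie_heis_ff i j a b : lie (heis_f i a) (heis_f j b) = 0.
Proof.
apply: (congr2 pair) => //=.
by rewrite big1 // => l _; rewrite !ffunE !mul0r subrr.
Qed.

Lemma lie_heis_g a u : lie (heis_g a) u = 0.
Proof.
apply: (congr2 pair) => //=.
by rewrite big1 // => l _; rewrite !ffunE mul0r mulr0 subrr.
Qed.

Lemma heis_decomp (u : H) :
  u = \sum_(i < k) heis_e i (u.1.1 i) + \sum_(i < k) heis_f i (u.1.2 i)
      + heis_g u.2.
Proof.
have sumE (x : {ffun 'I_k -> A}) :
    \sum_(i < k) [ffun j => if j == i then x i else 0] = x.
  apply/ffunP=> j; rewrite sum_ffunE (bigD1 j) //= big1 ?addr0 => [|i ij].
    by rewrite ffunE eqxx.
  by rewrite ffunE eq_sym (negPf ij).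
have pE (x y : {ffun 'I_k -> A}) (z : A) (p : H) :
  p.1.1 = x -> p.1.2 = y -> p.2 = z -> p = (x, y, z) :> H.
  by case: p => [[? ?] ?] /= -> -> ->.
case: u => [[x y] z] /=; apply/esym/pE => /=.
- rewrite !raddf_sum /= sumE addr0.
  by rewrite [X in _ + X]big1 ?addr0.
- rewrite !raddf_sum /= sumE addr0.
  by rewrite [X in X + _]big1 ?add0r.
- rewrite !raddf_sum /=.
  by rewrite ![\sum_(_ < _) 0]big1 ?add0r.
Qed.

Lemma dim_heisenberg : \dim {:H} = ((k.*2).+1 * \dim {:A})%N.
Proof.
rewrite !dimvf.
have -> : dim H = (#|'I_k| * dim A + #|'I_k| * dim A + dim A)%N by [].
by rewrite card_ord -mulnDl addnn mulSn addnC.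
Qed.

End Heisenberg.

(* Main.v *)
(* For b in A, write b g for the corresponding element of A g. The cocycle
   identity on H_1(A) forces omega(a g, b g) = 0, omega(a g, b e) = alpha(a b)
   and omega(a g, b f) = beta(a b) for two linear forms alpha, beta on A, and
   leaves omega free on A e + A f. Hence b g is in the radical iff alpha and
   beta vanish on the ideal b A. Every nonzero ideal meets the socle S, and
   b A = R b for b in S, so A g meets the radical trivially iff alpha and beta
   separate S, which is possible iff dim S <= 2. Then the orthogonal U of A g in
   A e + A f has dimension dim A, and omega is nondegenerate iff its restriction
   to U is, which can be achieved iff dim A is even. For k >= 2, the identity on
   (a e_i, f_i, b e_j) and (a e_i, f_i, b f_j) with i != j puts A g in the
   radical. *)

Require Import Defs.
From mathcomp Require Import all_boot all_order all_algebra falgebra.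
From HB Require Import structures.
From mathcomp Require Import boolp ring.

Set Implicit Arguments.
Unset Strict Implicit.
Unset Printing Implicit Defensive.

Import GRing.Theory Num.Theory.
Local Open Scope ring_scope.

(** * Ideals and the socle of a local algebra *)

Section Socle.
Variables (K : fieldType) (A : comFalgType K).
Implicit Types (V N : {vspace A}) (x y b c n : A).

Lemma ideal_sub_maximal V :
  idealr_closed (mem V) ->
  exists2 M : {vspace A}, maximal_ideal (mem M) & (V <= M)%VS.
Proof.
have [m] := ubnP (\dim {:A} - \dim V).
elim: m V => // m IHm V codimV idV.
have [maxV | nmaxV] := pselect (maximal_ideal (mem V)); first by exists V.
have [W [[W0 W1 Wlin] sVW [x Wx Vx]]] : exists W : {pred A},
    [/\ idealr_closed W, {subset V <= W} & exists2 x, x \in W & x \notin V].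
  apply: contrapT => noW; apply: nmaxV; split=> // W idW sVW x.
  apply/idP/idP => [Wx | /sVW //].
  by apply: contrapT => /negP Vx; apply: noW; exists W; split=> //; exists x.
(* [W] is a mere predicate; adjoining one element [x] of it to [V] gives a subspace ideal of smaller
   codimension, proper because it lies in [W]. *)
pose V' := (limg (amulr x) + V)%VS.
have sVV' : (V <= V')%VS := addvSr _ _.
have V'x : x \in V'.
  apply: subvP (addvSl _ _) _ _.
  by apply/memv_imgP; exists 1; rewrite ?memvf // lfunE /= mul1r.
have sV'W u : u \in V' -> u \in W.
  case/memv_addP => _ /memv_imgP[a _ ->] [v Vv ->]; rewrite lfunE /=.
  exact: Wlin (sVW _ Vv).
have idV' : idealr_closed (mem V').
  split; first exact: mem0v.
    by apply: contra W1; apply: sV'W.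
  move=> a _ w /memv_addP[_ /memv_imgP[b _ ->] [v Vv ->]] V'w.
  rewrite mulrDr rpredD // rpredD //.
    apply: subvP (addvSl _ _) _ _.
    by apply/memv_imgP; exists (a * b); rewrite ?memvf // !lfunE /= mulrA.
  apply: subvP sVV' _ _.
  by case: idV => V0 _ /(_ a v 0 Vv V0); rewrite addr0.
have ltVV' : (\dim V < \dim V')%N.
  rewrite ltn_neqAle dimvS // andbT; apply: contra Vx => dVV'.
  by rewrite (eqP (_ : V == V')) // eqEdim sVV' -(eqP dVV') /=.
have [|M maxM sV'M] := IHm V' _ idV'.
  rewrite ltnS in codimV; apply: leq_trans codimV.
  by rewrite ltn_sub2l // (leq_trans ltVV') ?dimvS ?subvf.
by exists M => //; apply: subv_trans sV'M.
Qed.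

Lemma local_ideal_sub N V :
  local_ring A -> maximal_ideal (mem N) -> idealr_closed (mem V) ->
  (V <= N)%VS.
Proof.
case=> M0 _ uniqM0 maxN /ideal_sub_maximal[M maxM sVM].
apply/subvP => v /(subvP sVM) Mv.
have Nv0 : (v \in N) = (v \in M0) := uniqM0 _ maxN v.
by rewrite Nv0 -(uniqM0 _ maxM v).
Qed.

(** The annihilator of a nonzero [x] is a proper ideal, hence lies in [N]; if it contained [1 - n],
    then [1] would be in [N]. *)
Lemma local_mulr_eq0 N n x :
  local_ring A -> maximal_ideal (mem N) -> n \in N -> x * (1 - n) = 0 -> x = 0.
Proof.
move=> locA maxN Nn xn0; apply/eqP/negPn/negP => x0.
have [[_ N1 _] _] := maxN.
have /subvP sxN : (lker (amulr x) <= N)%VS.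
  apply: local_ideal_sub => //; split; first exact: mem0v.
    by rewrite memv_ker lfunE /= mul1r.
  move=> a u v; rewrite !memv_ker !lfunE /= => /eqP ux /eqP vx.
  by rewrite mulrDl -mulrA ux vx mulr0 addr0.
have /sxN N1n : 1 - n \in lker (amulr x) by rewrite memv_ker lfunE /= mulrC xn0.
have N1' : 1 \in N by rewrite -(subrK n 1) rpredD.
by rewrite [_ \in _]N1' in N1.
Qed.

(* A minimal principal ideal [x A] is killed by [N]: if [x n != 0], then *)
(* [x n A = x A], so [x (1 - n a) = 0] for some [a], which forces [x = 0]. *)
Lemma local_socle_mul N b :
  local_ring A -> maximal_ideal (mem N) -> b != 0 ->
  exists2 c, b * c != 0 & b * c \in annihilator N.
Proof.
move=> locA maxN; have [m] := ubnP (\dim (limg (amull b))).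
elim: m b => // m IHm b dimb b0.
have [bN0 | /negP bN] := boolP (b \in annihilator N).
  by exists 1; rewrite mulr1.
have [n Nn bn0] : exists2 n, n \in N & b * n != 0.
  apply: contrapT => noN; apply: bN; apply/annihilatorP => n Nn.
  by apply/eqP/negPn/negP => bn0; apply: noN; exists n.
have sbnb : (limg (amull (b * n)%R) <= limg (amull b))%VS.
  apply/subvP => _ /memv_imgP[a _ ->]; apply/memv_imgP.
  by exists (n * a); rewrite ?memvf // !lfunE /= mulrA.
have [|c] := IHm (b * n) _ bn0; last by rewrite -mulrA; exists (n * c).
rewrite ltnS in dimb; apply: leq_trans dimb.
rewrite ltn_neqAle dimvS // andbT; apply: contra b0 => dbn.
have /eqP ebn : limg (amull (b * n)) == limg (amull b).
  by rewrite eqEdim sbnb (eqP dbn) /=.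
have : b \in limg (amull (b * n)).
  by rewrite ebn; apply/memv_imgP; exists 1; rewrite ?memvf // lfunE /= mulr1.
case/memv_imgP => a _; rewrite lfunE /= => ba.
apply/eqP/(local_mulr_eq0 (n := a * n) locA maxN).
  case: maxN => -[N0 _ Nlin] _.
  by have := Nlin a n 0 Nn N0; rewrite addr0.
by rewrite mulrBr mulr1 [a * n]mulrC mulrA -ba subrr.
Qed.

End Socle.

(** * Pairings nondegenerate on the left *)

Section Pairing.
Variables (K : fieldType) (W V : vectType K).
Variable B : {bilinear W -> V -> K | *%R & *%R}.

Definition gram : 'M[K]_(\dim {:W}, \dim {:V}) :=
  \matrix_(i, j) B (vbasis fullv)`_i (vbasis fullv)`_j.

Hypothesis ndB : forall x, (forall y, B x y = 0) -> x = 0.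

(** A row vector killed by [gram] lists the coordinates of an element of the left radical. *)
Lemma row_free_gram : row_free gram.
Proof.
rewrite -kermx_eq0; apply/rowV0P => u /sub_kermxP uB0.
pose x := \sum_i u 0 i *: (vbasis {:W})`_i.
have x0 : x = 0.
  apply: ndB => y; rewrite (coord_vbasis (memvf y)) linear_sumr big1 // => j _.
  rewrite linearZr_LR linear_sumlz /= (_ : \sum_(i < _) _ = 0) ?mulr0 //.
  have := congr1 (fun v : 'rV_ _ => v 0 j) uB0; rewrite !mxE => uB0j.
  rewrite -[RHS]uB0j.
  by apply: eq_bigr => i _; rewrite linearZl_LR mxE.
have := basis_free (vbasisP {:W}) => /freeP free_b.
by apply/rowP => i; rewrite mxE; apply: free_b.
Qed.

(** Pairing with a basis of [W] maps [V] to row vectors with kernel [U]; a right inverse of [gram]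
    makes this map onto, and rank-nullity concludes. *)
Lemma right_kernel_dim : exists U : {vspace V},
  (forall y, y \in U <-> forall x, B x y = 0) /\
  (\dim U + \dim {:W})%N = \dim {:V}.
Proof.
pose T y : 'rV[K]_(\dim {:W}) := \row_i B (vbasis {:W})`_i y.
have Tlin : linear T.
  by move=> a y y'; apply/rowP => i; rewrite !mxE linearPr.
pose T' : {linear V -> 'rV_ _} :=
  HB.pack T (GRing.isLinear.Build _ _ _ _ T Tlin).
exists (lker (linfun T')); split=> [y | ].
  rewrite memv_ker lfunE /=; split=> [/eqP Ty0 x | Bxy].
    rewrite (coord_vbasis (memvf x)) linear_sumlz big1 // => i _.
    have := congr1 (fun v : 'rV_ _ => v 0 i) Ty0; rewrite !mxE => Bi.
    by rewrite linearZl_LR Bi mulr0.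
  by apply/eqP/rowP => i; rewrite !mxE.
rewrite -[RHS](limg_ker_dim (linfun T')) capfv.
suff -> : limg (linfun T') = fullv.
  by congr addn; rewrite [RHS]dimvf dim_matrix; apply/esym/mul1n.
apply/vspaceP => r; rewrite memvf; apply/memv_imgP.
have [X BX] := row_freeP row_free_gram.
pose c := X *m r^T.
exists (\sum_j c j 0 *: (vbasis {:V})`_j); first exact: memvf.
rewrite lfunE; apply/rowP => i; rewrite mxE linear_sumr /=.
have /(congr1 (fun u : 'cV_ _ => u i 0)) : gram *m c = r^T.
  by rewrite mulmxA BX mul1mx.
rewrite !mxE => <-; apply: eq_bigr => j _.
by rewrite linearZr_LR mulrC !mxE.
Qed.

End Pairing.

(** * Alternating forms and parity of the dimension *)

Section Alternating.
Variables (K : numFieldType) (V : vectType K).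

(** The Gram matrix is skew-symmetric, so in odd size its determinant equals its own opposite and
    vanishes. *)
Lemma alternating_even_dim (omega : {biscalar V}) :
  (forall x, omega x x = 0) ->
  (forall x, (forall y, omega x y = 0) -> x = 0) -> ~~ odd (\dim {:V}).
Proof.
move=> alt nd; apply/negP => oddn.
have skew x y : omega x y = - omega y x.
  have := alt (x + y); rewrite linearDl !linearDr !alt add0r addr0 => /eqP.
  by rewrite addr_eq0 => /eqP.
have := row_free_gram nd; rewrite row_free_unit unitmxE unitfE.
have tr : (gram omega)^T = - gram omega.
  by apply/matrixP => i j; rewrite !mxE skew.
have := det_tr (gram omega); rewrite tr -scaleN1r detZ.
by rewrite -signr_odd oddn mulN1r => /eqP; rewrite eqNr => ->.
Qed.

(** In a basis of [U] the form is antidiagonal with alternating signs, so pairing [x] with the basis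
    vector of index [rev_ord i] isolates coordinate [i] of [x]. *)
Lemma alternating_nondegenerate_on (U : {vspace V}) : ~~ odd (\dim U) ->
  exists2 Q : {biscalar V}, forall x, Q x x = 0 &
    forall x, x \in U -> {in U, forall y, Q x y = 0} -> x = 0.
Proof.
move=> evenU; pose c (i : 'I_(\dim U)) : V -> K := coord (vbasis U) i.
have cb (i j : 'I_(\dim U)) : c j (vbasis U)`_i = (i == j)%:R.
  exact: coord_free (basis_free (vbasisP U)).
(* Since [\dim U] is even, [i] and [rev_ord i] have opposite parities, so the *)
(* signs make [q] alternating.                                               *)
pose q x y := \sum_(i < \dim U) (-1) ^+ i * (c i x * c (rev_ord i) y).
have cP i a x x' : c i (a *: x + x') = a * c i x + c i x' by exact: linearP.
have qP : bilinear_for *%R *%R q.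
  split=> [y a x x' | x a y y'] /=; rewrite mulr_sumr -big_split /=;
    apply: eq_bigr => i _; rewrite cP.
    by rewrite mulrDl mulrDr -mulrA mulrCA.
  rewrite mulrDr mulrDr; congr (_ + _).
  by rewrite [c i x * _]mulrCA [LHS]mulrCA.
pose Q : {biscalar V} := HB.pack q (bilinear_isBilinear.Build _ _ _ _ _ _ q qP).
have qC x y : q x y = - q y x.
  rewrite /q (reindex_inj rev_ord_inj) -sumrN; apply: eq_bigr => i _ /=.
  rewrite rev_ordK [c i y * _]mulrC -mulNr; congr (_ * _).
  by rewrite -[RHS]mulN1r -exprS -signr_odd oddB // (negPf evenU) signr_odd.
exists Q => [x | x Ux Qx0].
  by apply/eqP; rewrite -eqNr; apply/eqP; rewrite -[LHS]qC.
rewrite (coord_vbasis Ux) big1 // => i _.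
have bi : (vbasis U)`_(rev_ord i) \in U.
  by apply: vbasis_mem; rewrite mem_nth ?size_tuple.
have : q x _ = 0 := Qx0 _ bi.
rewrite /q (bigD1 i) // big1 => [|j ji]; rewrite cb.
  rewrite eqxx mulr1 /= addr0 => /eqP; rewrite mulf_eq0 signr_eq0 => /eqP cix0.
  by rewrite [coord _ _ _]cix0 scale0r.
by rewrite (inj_eq rev_ord_inj) eq_sym (negPf ji) !mulr0.
Qed.

End Alternating.

Lemma row_embedding (K : fieldType) (V : vectType K) (S : {vspace V}) m :
  (\dim S <= m)%N ->
  exists T : 'Hom(V, 'rV[K]_m), {in S, forall v, T v = 0 -> v = 0}.
Proof.
move=> leSm.
(* Coordinates along a basis of [S], padded with zeros: the sum has at most one term, and none once
   [j] reaches [\dim S]. *)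
pose t v : 'rV[K]_m :=
  \row_j \sum_(i < \dim S | i == j :> nat) coord (vbasis S) i v.
have tlin : linear t.
  move=> a v w; apply/rowP => j; rewrite !mxE mulr_sumr -big_split /=.
  by apply: eq_bigr => i _; rewrite linearP.
pose T : {linear V -> 'rV_m} := HB.pack t (GRing.isLinear.Build _ _ _ _ t tlin).
exists (linfun T) => v Sv; rewrite lfunE => Tv0.
rewrite (coord_vbasis Sv) big1 // => i _.
have /rowP/(_ (widen_ord leSm i)) := Tv0.
by rewrite !mxE (big_pred1 i) => [-> | j] //; rewrite scale0r.
Qed.

Lemma heis_g_linear (K : fieldType) k (A : comFalgType K) :
  linear (@heis_g K k A).
Proof.
move=> r a b; apply: (congr2 pair) => //.
by apply: (congr2 pair); rewrite /= scaler0 addr0.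
Qed.

(** * Consequences of the cocycle identity *)

Section CocycleValues.
Variables (K : fieldType) (k : nat) (A : comFalgType K).
Variable omega : {biscalar (heisenberg k A)}.
Hypothesis omegaP : @scalar_2cocycle _ (heisenberg k A) omega.

Lemma lie_heis_fe (i j : 'I_k) (a b : A) :
  lie (heis_f i a) (heis_e j b) = if i == j then - heis_g k (b * a) else 0.
Proof.
rewrite [LHS]heis_bracketC -[heis_bracket _ _]/(lie _ _) lie_heis_ef eq_sym.
by case: eqP => // _; rewrite oppr0.
Qed.

Lemma lie_heis_gr (a : A) (u : heisenberg k A) : lie u (heis_g k a) = 0.
Proof.
by rewrite [LHS]heis_bracketC -[heis_bracket _ _]/(lie _ _) lie_heis_g oppr0.
Qed.

Let lieE := (lie_heis_ef, lie_heis_fe, lie_heis_ee, lie_heis_ff, lie_heis_g,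
  lie_heis_gr, linear0l, linearNl, addr0, mulr1, eqxx).

Lemma cocycle_gg (i : 'I_k) (a b : A) : omega (heis_g k a) (heis_g k b) = 0.
Proof.
by have := omegaP (heis_e i a) (heis_f i 1) (heis_g k b); rewrite !lieE.
Qed.

(** Bracketing [a f_i] with [e_i] and with [b e_i] yields [a g] and [a b g] with opposite signs. *)
Lemma cocycle_ge (i : 'I_k) (a b : A) :
  omega (heis_g k a) (heis_e i b) = omega (heis_g k (a * b)) (heis_e i 1).
Proof.
have := omegaP (heis_e i 1) (heis_f i a) (heis_e i b).
by rewrite !lieE mul1r [b * a]mulrC => /eqP; rewrite subr_eq0 => /eqP.
Qed.

Lemma cocycle_gf (i : 'I_k) (a b : A) :
  omega (heis_g k a) (heis_f i b) = omega (heis_g k (a * b)) (heis_f i 1).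
Proof.
have := omegaP (heis_e i a) (heis_f i 1) (heis_f i b).
by rewrite !lieE => /eqP; rewrite subr_eq0 => /eqP.
Qed.

(** Since [e_j] commutes with [e_i] and [f_i], the bracket of [a e_i] and [f_i], which is [a g],
    stands alone in the identity. *)
Lemma cocycle_ge0 (i j : 'I_k) (a b : A) :
  i != j -> omega (heis_g k a) (heis_e j b) = 0.
Proof.
move=> ij; have := omegaP (heis_e i a) (heis_f i 1) (heis_e j b).
by rewrite !lieE (negPf ij) linear0l !addr0.
Qed.

Lemma cocycle_gf0 (i j : 'I_k) (a b : A) :
  i != j -> omega (heis_g k a) (heis_f j b) = 0.
Proof.
move=> ij; have := omegaP (heis_e i a) (heis_f i 1) (heis_f j b).
by rewrite !lieE eq_sym (negPf ij) linear0l !addr0.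
Qed.

Lemma heis_g_radical (a : A) : (0 < k)%N ->
  (forall i b, omega (heis_g k a) (heis_e i b) = 0) ->
  (forall i b, omega (heis_g k a) (heis_f i b) = 0) ->
  forall u, omega (heis_g k a) u = 0.
Proof.
move=> k_gt0 oe0 of0 u; rewrite (heis_decomp u) !linearDr !linear_sumr.
by rewrite (cocycle_gg (Ordinal k_gt0)) !big1 ?addr0.
Qed.

End CocycleValues.

(** * The case [k >= 2] *)

Lemma heisenberg_not_symplectic (K : fieldType) (k : nat) (A : comFalgType K) :
  (2 <= k)%N -> ~ symplectic_lie (heisenberg k A).
Proof.
move=> k2 [omega [_ nd omegaP]].
have other (j : 'I_k) : exists i : 'I_k, i != j.
  have [j0 | j0] := eqVneq (j : nat) 0%N.
    by exists (Ordinal k2); rewrite -val_eqE /= j0.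
  by exists (Ordinal (ltnW k2)); rewrite -val_eqE /= eq_sym.
have : heis_g k (1 : A) = 0.
  apply: nd; apply: heis_g_radical => // [|j b|j b]; first exact: ltnW.
    by have [i ij] := other j; apply: cocycle_ge0 ij.
  by have [i ij] := other j; apply: cocycle_gf0 ij.
by case=> /eqP; rewrite oner_eq0.
Qed.

(** * The case [k = 1] *)

Section HeisenbergOne.
Variables (K : numFieldType) (A : comFalgType K) (N : {vspace A}).
Hypothesis sumN : (1 + N)%VS = fullv.

(** The dimension of the Lie algebra is [3 * \dim {:A}], of the same parity as [\dim {:A}]. *)
Lemma symplectic_heisenberg1_even :
  symplectic_lie (heisenberg 1 A) -> ~~ odd (\dim {:A}).
Proof.
case=> omega [alt nd _].
by have := alternating_even_dim alt nd; rewrite dim_heisenberg oddM.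
Qed.

Lemma symplectic_heisenberg1_socle :
  symplectic_lie (heisenberg 1 A) -> (\dim (annihilator N) <= 2)%N.
Proof.
case=> omega [_ nd omegaP].
(* The pair (alpha, beta); its injectivity on the socle bounds the dimension by 2. *)
pose t a : 'rV[K]_2 := \row_j
  omega (heis_g 1 a) (if j == 0 then heis_e 0 1 else heis_f 0 1).
have tlin : linear t.
  move=> c a b; apply/rowP => j; rewrite !mxE -linearPl; congr (omega _ _).
  exact: heis_g_linear.
pose T : {linear A -> 'rV_2} := HB.pack t (GRing.isLinear.Build _ _ _ _ t tlin).
have capT0 : (annihilator N :&: lker (linfun T) = 0)%VS.
  apply/eqP; rewrite -subv0; apply/subvP => a; rewrite memv_cap memv_ker lfunE.
  rewrite memv0 => /andP[/annihilatorP Sa /eqP/rowP ta].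
  have mulS c : exists r, a * c = r *: a.
    have : c \in (1 + N)%VS by rewrite sumN memvf.
    case/memv_addP => _ /vlineP[r ->] [n Nn ->].
    by exists r; rewrite mulrDr (Sa n) // addr0 -scalerAr mulr1.
  have gZ r : heis_g 1 (r *: a) = r *: heis_g 1 a.
    exact: scalable_linear (@heis_g_linear K 1 A) r a.
  have: heis_g 1 a = 0; last by case=> ->.
  apply: nd; apply: heis_g_radical => // i b; rewrite ord1.
    rewrite cocycle_ge //; have [r ->] := mulS b.
    by have := ta 0; rewrite !mxE gZ linearZl_LR /= => ->; rewrite mulr0.
  rewrite cocycle_gf //; have [r ->] := mulS b.
  by have := ta 1; rewrite !mxE gZ linearZl_LR /= => ->; rewrite mulr0.
rewrite -(limg_dim_eq capT0); apply: leq_trans (dimvS (subvf _)) _.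
by rewrite dimvf dim_matrix.
Qed.

Lemma heisenberg1_symplectic :
  local_ring A -> maximal_ideal (mem N) ->
  ~~ odd (\dim {:A}) -> (\dim (annihilator N) <= 2)%N ->
  symplectic_lie (heisenberg 1 A).
Proof.
move=> locA maxN evenA /row_embedding[T injT].
(* The two coordinates of [T] serve as alpha and beta; [b] pairs [A g] with [A e + A f]. *)
pose b (a : A) (p : A * A) : K := T (a * p.1) 0 0 + T (a * p.2) 0 1.
have bP : bilinear_for *%R *%R b.
  split=> [p r a a' | a r p p']; rewrite /b /=.
    by rewrite !mulrDl -!scalerAl !linearP !mxE; ring.
  by rewrite !mulrDr -!scalerAr !linearP !mxE; ring.
pose B : {bilinear A -> (A * A)%type -> K | *%R & *%R} :=
  HB.pack b (bilinear_isBilinear.Build _ _ _ _ _ _ b bP).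
(* A nonzero [a] has a nonzero multiple [a * c] in the socle, where [T] is injective; [(c, 0)] and
   [(0, c)] read off the coordinates of [T (a * c)]. *)
have ndB a : (forall p, B a p = 0) -> a = 0.
  move=> Ba0; apply/eqP/negPn/negP => a0.
  have [c ac0 Sac] := local_socle_mul locA maxN a0.
  case/eqP: ac0; apply: injT => //; apply/rowP => j; rewrite mxE.
  have := Ba0 (c, 0); have := Ba0 (0, c).
  rewrite /= /b /= mulr0 linear0 !mxE addr0 add0r.
  by have /orP[/eqP -> | /eqP ->] : (j == 0) || (j == 1) by case: j => -[|[|]].
have [U [UP dimU]] := right_kernel_dim ndB.
have evenU : ~~ odd (\dim U).
  have := congr1 odd dimU; rewrite oddD (negPf evenA) addbF => ->.
  by rewrite dimvf oddD addbb.
have [Q altQ ndQ] := alternating_nondegenerate_on evenU.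
pose p (u : heisenberg 1 A) := (u.1.1 0, u.1.2 0).
have pP r u v : p (r *: u + v) = r *: p u + p v.
  by apply: (congr2 pair); rewrite /= !ffunE.
pose w u v := Q (p u) (p v) + B u.2 (p v) - B v.2 (p u).
have wP : bilinear_for *%R *%R w.
  by split=> [v r u u' | u r v v']; rewrite /w pP !linearPl !linearPr /=; ring.
pose omega : {biscalar (heisenberg 1 A)} :=
  HB.pack w (bilinear_isBilinear.Build _ _ _ _ _ _ w wP).
exists omega; split.
- by move=> u; change (w u u = 0); rewrite /w altQ add0r subrr.
- move=> u wu0.
  (* Testing against [A g] puts [p u] in [U]; testing against [U], where [B] vanishes, kills [p u]
     through [Q]; what remains is [B u.2], which kills [u.2]. *)
  have Up : p u \in U.
    apply/UP => a; have : w u (heis_g 1 a) = 0 := wu0 _.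
    rewrite /w (_ : p (heis_g 1 a) = 0); last first.
      by apply: (congr2 pair); rewrite /= ffunE.
    by rewrite !linear0r !add0r => /eqP; rewrite oppr_eq0 => /eqP.
  have w0 q : Q (p u) q + B u.2 q = 0.
    pose v : heisenberg 1 A := ([ffun=> q.1], [ffun=> q.2], 0).
    have pv : p v = q.
      by rewrite [RHS]surjective_pairing; apply: (congr2 pair); rewrite ffunE.
    have : w u v = 0 := wu0 v.
    by rewrite /w pv linear0l subr0.
  have p0 : p u = 0.
    apply: ndQ => // q /UP Bq; have := w0 q.
    by rewrite Bq addr0.
  have u2 : u.2 = 0.
    by apply: ndB => q; have := w0 q; rewrite p0 linear0l add0r.
  case: u p0 u2 {wu0 Up w0} => [[x y] z] [/= x0 y0] ->.
  by apply: (congr2 pair) => //; apply: (congr2 pair);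
     apply/ffunP => i; rewrite ord1 ffunE.
- have T3 a1 a2 a3 j :
    a1 + a2 + a3 = 0 -> T a1 0 j + T a2 0 j + T a3 0 j = 0.
    move=> /(congr1 (fun a => T a 0 j)).
    by rewrite !linearD linear0 !mxE.
  have wlie x y z : w (lie x y) z =
      b (x.1.1 0 * y.1.2 0 - y.1.1 0 * x.1.2 0) (p z).
    have plie : p (lie x y) = 0 by apply: (congr2 pair); rewrite ffunE.
    by rewrite /w plie linear0r linear0l subr0 add0r /lie /= big_ord1.
  move=> x y z; change (w (lie x y) z + w (lie y z) x + w (lie z x) y = 0).
  (* For each coordinate of [T], the arguments sum to a 3 by 3 determinant with two equal
     columns. *)
  by rewrite !wlie /b /= [X in X + _]addrACA [LHS]addrACA !T3 ?addr0 //; ring.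
Qed.

End HeisenbergOne.

Theorem theorem5 (R : realType) (A : comFalgType R) (locA : local_ring A)
    (N : {vspace A}) (maxN : maximal_ideal (mem N))
    (dirN : directv (1 + N)) (sumN : (1 + N)%VS = fullv) :
  (symplectic_lie (heisenberg 1 A) <->
     ~~ odd (\dim {:A}) /\ (\dim (annihilator N) <= 2)%N) /\
  (forall k : nat, (2 <= k)%N -> ~ symplectic_lie (heisenberg k A)).
Proof.
split=> [|k]; last exact: heisenberg_not_symplectic.
split=> [sympA | [evenA dimS]]; last exact: heisenberg1_symplectic dimS.
split; first exact: symplectic_heisenberg1_even.
exact: symplectic_heisenberg1_socle.
Qed.
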